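(* Let $w_1,\dots,w_n$ be positive real numbers, let $H_{\mathfrak W}=\prod_{k=1}^n\{0,w_k\}\subseteq\mathbb R^n$ be equipped with the $\ell^1$ metric, and let $X\subseteq H_{\mathfrak W}$ have at least two points. Then $$M(X)=\frac12\sum_{k=1}^n w_k-2\,d_2(\boldsymbol h,Z_X)^2 .$$
   Context: For a finite metric space $(X,d)$ with points $x_0,\dots,x_m$ and distance matrix $D_X=(d(x_i,x_j))_{i,j}$, the $M$-constant is $M(X)=\sup\{\langle D_X\boldsymbol\xi,\boldsymbol\xi\rangle:\boldsymbol\xi\in\mathbb R^{m+1},\ \sum_i\xi_i=1\}$. Here $\langle\cdot,\cdot\rangle$ is the usual inner product. Let $W=\mathrm{diag}(w_1,\dots,w_n)$ and let $\iota:\mathbb R^n\to\mathbb R^n$, $\iota(\boldsymbol x)=W^{-1/2}\boldsymbol x$. $Z_X$ is the smallest affine subspace of $\mathbb R^n$ containing $\iota(X)$, $\boldsymbol h=\frac12(\sqrt{w_1},\dots,\sqrt{w_n})^T$, and $d_2(\boldsymbol h,Z_X)$ is the Euclidean distance from $\boldsymbol h$ to $Z_X$. *)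

(* Defs.v *)
From HB Require Import structures.
From mathcomp Require Import all_boot all_order all_algebra finmap.
From mathcomp Require Import all_classical all_reals all_analysis.

Set Implicit Arguments.
Unset Strict Implicit.
Unset Printing Implicit Defensive.

Import Order.TTheory GRing.Theory Num.Theory.
Local Open Scope classical_set_scope.
Local Open Scope ring_scope.

Section Euclidean.
Variables (R : realType) (n : nat).
Implicit Types (x y p : 'cV[R]_n) (A : set 'cV[R]_n).

Definition dotp x y : R := \sum_(k < n) x k 0 * y k 0.

(* The library norm on matrices is the sup norm, hence these definitions. *)
Definition dist1 x y : R := \sum_(k < n) `|x k 0 - y k 0|.
Definition dist2 x y : R := Num.sqrt (\sum_(k < n) (x k 0 - y k 0) ^+ 2).

Definition dist2_set p A : R := inf [set dist2 p z | z in A].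

Definition affine_subspace A : Prop :=
  exists (p : 'cV[R]_n) (V : {vspace 'cV[R]_n}), A = [set p + v | v in [set` V]].

End Euclidean.

Section MConstant.
Variables (R : realType) (T : choiceType) (d : T -> T -> R) (X : {fset T}).

(* The points of X are numbered by the duplicate-free sequence underlying X. *)
Definition dist_matrix : 'M[R]_(#|` X|) :=
  \matrix_(i, j) d (tnth (in_tuple X) i) (tnth (in_tuple X) j).

(* The supremum is taken in the extended reals, where it always exists. *)
Definition Mconst : \bar R :=
  ereal_sup [set (dotp (dist_matrix *m xi) xi)%:E |
             xi in [set xi : 'cV[R]_(#|` X|) | \sum_i xi i 0 = 1]].

End MConstant.

Section WeightedCube.
Variables (R : realType) (n : nat) (w : 'I_n -> R).

Definition weighted_cube : set 'cV[R]_n :=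
  [set x | forall k, x k 0 = 0 \/ x k 0 = w k].

(* x |-> W^(-1/2) x with W = diag(w_1, ..., w_n) *)
Definition iota_w (x : 'cV[R]_n) : 'cV[R]_n :=
  diag_mx (\row_k (Num.sqrt (w k))^-1) *m x.

Definition Z_hull (X : {fset 'cV[R]_n}) : set 'cV[R]_n :=
  smallest (@affine_subspace R n) (iota_w @` [set` X]).

Definition h_w : 'cV[R]_n := 2^-1 *: \col_k Num.sqrt (w k).

End WeightedCube.

(* Main.v *)
Require Import Defs.
From HB Require Import structures.
From mathcomp Require Import all_boot all_order all_algebra finmap.
From mathcomp Require Import all_classical all_reals all_analysis.
From mathcomp Require Import ring lra.
Import Order.TTheory GRing.Theory Num.Theory.
Local Open Scope classical_set_scope.
Local Open Scope fset_scope.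
Local Open Scope ring_scope.

(** The map [iota_w] turns the l1 metric of the cube into a squared Euclidean
    distance: on [{0, w_k}] one has [|a - b| = a + b - 2 a b / w_k], which is
    [(a - b)^2 / w_k].  Let the coefficients [xi] have sum 1 and let
    [z = \sum_i xi_i iota_w(x_i)].  Expanding the squares, and using that the
    points of the cube satisfy [|iota_w x|^2 = 2 <h, iota_w x>] (they lie on the
    sphere of centre [h] through the origin), gives
      [<D xi, xi> = 4 <h, z> - 2 |z|^2 = 2 |h|^2 - 2 |h - z|^2]
    with [2 |h|^2 = (\sum_k w_k) / 2]; this is [quadratic_formE].
    As [xi] varies, [z] runs over all affine combinations of [iota_w @` X],
    that is over the affine hull [Z_hull w X] ([smallest_affine_rangeE]).  So the
    supremum of the quadratic form is governed by the infimum of [|h - z|] over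
    that hull; passing from one to the other only uses that [t |-> c - 2 t^2] is
    decreasing and continuous on the nonnegative reals ([ereal_sup_sub_sqr]). *)

Section AffineHull.
Local Open Scope classical_set_scope.
Local Open Scope ring_scope.
Context {R : realType} {n m : nat}.
Implicit Types (y : 'I_m -> 'cV[R]_n) (c : 'cV[R]_m).

Definition lincomb y c : 'cV[R]_n := \sum_i c i 0 *: y i.

Lemma sum_eq_nat (i0 : 'I_m) : \sum_i (i == i0)%:R = 1 :> R.
Proof. by rewrite (bigD1 i0) //= eqxx big1 ?addr0 // => i /negbTE ->. Qed.

Lemma sum_delta_mx (i0 : 'I_m) :
  \sum_i (delta_mx i0 0 : 'cV[R]_m) i 0 = 1.
Proof. by under eq_bigr do rewrite mxE andbT; exact: sum_eq_nat. Qed.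

Lemma lincomb_translate y c (p : 'cV[R]_n) : \sum_i c i 0 = 1 ->
  lincomb y c = p + \sum_i c i 0 *: (y i - p).
Proof.
move=> c1.
under eq_bigr do rewrite scalerBr.
by rewrite sumrB -scaler_suml c1 scale1r addrC subrK.
Qed.

Lemma affine_subspace_lincomb (A : set 'cV[R]_n) y c :
  affine_subspace A -> range y `<=` A -> \sum_i c i 0 = 1 -> A (lincomb y c).
Proof.
move=> [p [V ->]] yA c1.
exists (\sum_i c i 0 *: (y i - p)); last by rewrite -lincomb_translate.
apply: memv_suml => i _; apply: memvZ.
by have [v Vv <-] := yA _ (imageT y i); rewrite addrC addKr.
Qed.

(** Taking [y i0] as origin, the direction is spanned by the differences
    [y i - y i0].  A combination of those with arbitrary coefficients becomes an
    affine combination of the [y i] once [y i0] absorbs the missing weight. *)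
Lemma affine_subspace_lincombs y (i0 : 'I_m) :
  affine_subspace
    (lincomb y @` [set c : 'cV[R]_m | \sum_i c i 0 = 1]).
Proof.
pose b := [tuple y i - y i0 | i < m].
have bE (i : 'I_m) : b`_i = y i - y i0 by rewrite -tnth_nth tnth_mktuple.
exists (y i0), <<b>>%VS; apply/seteqP; split=> [_ [c /= c1 <-]|_ [v bv <-]].
  exists (\sum_i c i 0 *: (y i - y i0)); last by rewrite -lincomb_translate.
  apply: memv_suml => i _; apply: memvZ; apply: memv_span.
  by rewrite -bE mem_nth // size_tuple.
pose a i := coord b i v.
pose c : 'cV[R]_m := \col_i a i + (1 - \sum_j a j) *: delta_mx i0 0.
have c1 : \sum_i c i 0 = 1.
  under eq_bigr do rewrite !mxE andbT.
  by rewrite big_split /= -mulr_sumr sum_eq_nat mulr1 addrC subrK.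
exists c => //; rewrite (lincomb_translate _ _ (y i0) c1); congr (_ + _).
rewrite (coord_span (X := b) bv); apply: eq_bigr => i _; rewrite bE !mxE andbT.
by have [->|_] := eqVneq i i0; rewrite ?subrr ?scaler0 // mulr0 addr0.
Qed.

Lemma smallest_affine_rangeE y (i0 : 'I_m) :
  smallest (@affine_subspace R n) (range y) =
  lincomb y @` [set c : 'cV[R]_m | \sum_i c i 0 = 1].
Proof.
apply/seteqP; split=> [z|_ [c c1 <-] A [affA yA]]; last first.
  exact: affine_subspace_lincomb.
apply; split; first exact: affine_subspace_lincombs.
move=> _ [i _ <-]; exists (delta_mx i 0); first exact: sum_delta_mx.
rewrite /lincomb (bigD1 i) //= mxE !eqxx scale1r big1 ?addr0 // => j /negbTE ji.
by rewrite mxE ji scale0r.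
Qed.

End AffineHull.

Section QuadraticForm.
Context {R : realType}.

Lemma dist_endpoints (w a b : R) : 0 < w ->
  a = 0 \/ a = w -> b = 0 \/ b = w -> `|a - b| = a + b - 2 * (a * b / w).
Proof.
move=> w0; have w_neq0 : w != 0 by rewrite gt_eqF.
case=> ->; case=> ->; rewrite ?subr0 ?sub0r ?subrr ?normrN ?normr0 ?(gtr0_norm w0);
  by field.
Qed.

Lemma dist2_sqr {n} (x y : 'cV[R]_n) :
  dist2 x y ^+ 2 = \sum_k (x k 0 - y k 0) ^+ 2.
Proof. by rewrite sqr_sqrtr // sumr_ge0 // => k _; exact: sqr_ge0. Qed.

(** The quadratic form is a sum over the coordinates [k]: with
    [a = \sum_i xi_i x_i(k)], the coordinate [k] contributes
    [2 a - 2 a^2 / w_k = w_k / 2 - 2 (sqrt w_k / 2 - a / sqrt w_k)^2]. *)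
Lemma quadratic_formE {n m} (w : 'I_n -> R) (x : 'I_m -> 'cV[R]_n)
    (xi : 'cV[R]_m) :
  (forall k, 0 < w k) -> (forall i, weighted_cube w (x i)) ->
  \sum_i xi i 0 = 1 ->
  dotp ((\matrix_(i, j) dist1 (x i) (x j)) *m xi) xi =
  2^-1 * (\sum_k w k) - 2 * dist2 (h_w w) (lincomb (iota_w w \o x) xi) ^+ 2.
Proof.
move=> w0 xw xi1; rewrite dist2_sqr !mulr_sumr -sumrB /dotp.
pose a k := \sum_i xi i 0 * x i k 0.
transitivity (\sum_k (2 * a k - 2 * (a k ^+ 2 / w k))); last first.
  apply: eq_bigr => k _; rewrite /lincomb summxE.
  under eq_bigr do rewrite mxE /= /iota_w mul_diag_mx !mxE mulrCA.
  rewrite -mulr_sumr -/(a k) !mxE.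
  have s0 : Num.sqrt (w k) != 0 by rewrite gt_eqF // sqrtr_gt0.
  rewrite -{1 2}(sqr_sqrtr (ltW (w0 k))); by field.
under eq_bigr do rewrite mxE mulr_suml.
transitivity (\sum_i \sum_j \sum_k
    xi i 0 * xi j 0 * (x i k 0 + x j k 0 - 2 * (x i k 0 * x j k 0 / w k))).
  apply: eq_bigr => i _; apply: eq_bigr => j _.
  rewrite mxE -mulrA mulrC -mulr_sumr (mulrC (xi j 0)); congr (_ * _).
  by apply: eq_bigr => k _; apply: dist_endpoints => //; exact: xw.
under eq_bigr do rewrite exchange_big.
rewrite exchange_big /=; apply: eq_bigr => k _.
transitivity (\sum_i (xi i 0 * x i k 0 + xi i 0 * a k
    - 2 * (xi i 0 * x i k 0 * (a k / w k)))).
  apply: eq_bigr => i _.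
  transitivity (\sum_j (xi i 0 * x i k 0 * xi j 0
      + xi i 0 * (xi j 0 * x j k 0)
      - 2 * (xi i 0 * x i k 0 / w k) * (xi j 0 * x j k 0))).
    by apply: eq_bigr => j _; ring.
  rewrite sumrB big_split /= -!mulr_sumr xi1 -/(a k); ring.
rewrite sumrB big_split /= -mulr_sumr -!mulr_suml xi1 -/(a k); ring.
Qed.

End QuadraticForm.

Section SupOfSquares.
Local Open Scope classical_set_scope.
Local Open Scope ring_scope.

Lemma ereal_sup_sub_sqr {R : realType} {T : Type} (A : set T) (f : T -> R)
    (c : R) : A !=set0 -> (forall t, A t -> 0 <= f t) ->
  ereal_sup [set (c - 2 * f t ^+ 2)%:E | t in A] =
  (c - 2 * inf (f @` A) ^+ 2)%:E.
Proof.
move=> [t0 At0] f0.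
have lb0 : lbound (f @` A) 0 by move=> _ [t At <-]; exact: f0.
have A0 : f @` A !=set0 by exists (f t0); exists t0.
have I0 : 0 <= inf (f @` A) by apply: lb_le_inf.
have fI t : A t -> inf (f @` A) <= f t.
  by move=> At; apply: ge_inf; [exists 0 | exists t].
set I := inf _ in I0 fI *; set S := ereal_sup _.
have Sge t : A t -> ((c - 2 * f t ^+ 2)%:E <= S)%E.
  by move=> At; apply: ereal_sup_ubound; exists t.
apply/eqP; rewrite eq_le; apply/andP; split.
  apply: ge_ereal_sup => _ [t At <-]; rewrite lee_fin lerD2l lerN2 ler_pM2l //.
  by rewrite ler_pXn2r // ?nnegrE ?f0 ?fI.
rewrite leNgt; apply/negP => SltI.
(* A value [r] below [c - 2 I^2] is beaten by any [t] with
   [f t < sqrt ((c - r) / 2)], a threshold that exceeds the infimum [I]. *)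
case: S Sge SltI => [r||] Sge; last 2 first.
- by rewrite ltNge leey.
- by have := Sge _ At0.
rewrite lte_fin => rI.
have cr0 : 0 <= (c - r) / 2 by have := sqr_ge0 I; lra.
have Is : I < Num.sqrt ((c - r) / 2).
  rewrite -[ltLHS](ger0_norm I0) -sqrtr_sqr ltr_sqrt;
    by have := sqr_ge0 I; lra.
have [_ [t At <-] ft] := inf_lt A0 Is.
have := Sge _ At; rewrite lee_fin; apply/negP; rewrite -ltNge.
have : f t ^+ 2 < Num.sqrt ((c - r) / 2) ^+ 2.
  by rewrite ltr_pXn2r // ?nnegrE ?f0 ?sqrtr_ge0.
rewrite sqr_sqrtr //; lra.
Qed.

End SupOfSquares.

Theorem theorem5p4 (R : realType) (n : nat) (w : 'I_n -> R)
    (w_gt0 : forall k, 0 < w k)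
    (X : {fset 'cV[R]_n}) (XH : ([set` X] `<=` weighted_cube w)%classic)
    (X_ge2 : (2 <= #|` X|)%N) :
  Mconst (@dist1 R n) X =
  (2^-1 * (\sum_(k < n) w k) - 2 * dist2_set (h_w w) (Z_hull w X) ^+ 2)%:E.
Proof.
pose x (i : 'I_#|` X|) : 'cV[R]_n := tnth (in_tuple X) i.
have xw i : weighted_cube w (x i) by apply: XH; exact: mem_tnth.
have iotaX : (iota_w w @` [set` X] = range (iota_w w \o x))%classic.
  apply/seteqP; split=> [_ [p /= Xp <-]|_ [i _ <-]]; last first.
    by exists (x i) => //; exact: mem_tnth.
  by have /tnthP[i ->] : p \in in_tuple X by []; exists i.
pose i0 : 'I_#|` X| := Ordinal (ltnW X_ge2).
rewrite /dist2_set /Z_hull iotaX (smallest_affine_rangeE _ i0) image_comp.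
rewrite -ereal_sup_sub_sqr; last 2 first.
- by exists (delta_mx i0 0); exact: sum_delta_mx.
- by move=> c _; exact: sqrtr_ge0.
congr ereal_sup; apply: eq_imagel => xi xi1; congr EFin.
exact: quadratic_formE.
Qed.
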